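(* Let $N_x,N_u,T$ be positive integers, $A\in\mathbb{R}^{N_x\times N_x}$, $B\in\mathbb{R}^{N_x\times N_u}$, and let support constraints be given, with resulting linear constraint system $S_c\vec\phi_u+C_c=0$ (assumed solvable). Decompose this system as $S_i\Phi_i+C_i=0$, $i=1,\dots,N_x$, and for each $i$ let the general solution be $\Phi_i=\omega_i+V_i\lambda_i$, $\lambda_i\in\mathbb{R}^{r_i}$, with $V_i\in\mathbb{R}^{(TN_u)\times r_i}$ of full column rank. Put $$M=[V_1,\dots,V_{N_x}]\in\mathbb{R}^{(TN_u)\times\sum_i r_i},\qquad N=[\omega_1,\dots,\omega_{N_x}]\in\mathbb{R}^{(TN_u)\times N_x}.$$ Then the constrained controllability $Y_c$ satisfies $$Y_c=\mathrm{volume}\big\{A^Tx_0 : \|(-MM^\dagger N+N)x_0\|_2^2\le 1\big\},$$ and this is equal to $$\det(A^T)\Big/\sqrt{\det\big((-MM^\dagger N+N)^\top(-MM^\dagger N+N)\big)}.$$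
   Context: $A^T$ denotes the $T$-th power of $A$; transposes are written $\top$; $M^\dagger$ is the Moore–Penrose pseudoinverse. The unknowns are matrices $\phi_u(t)\in\mathbb{R}^{N_u\times N_x}$, $t=0,\dots,T-1$; $\vec\phi_u$ is the vector of all their entries. For $i\in\{1,\dots,N_x\}$, $\Phi_i\in\mathbb{R}^{TN_u}$ contains the entries of $\vec\phi_u$ that multiply $x_0[i]$, i.e. it is the stack of the $i$-th columns $\phi_u(0)[:,i],\dots,\phi_u(T-1)[:,i]$. Define $\phi_x(0)=I$, $\phi_x(t+1)=A\phi_x(t)+B\phi_u(t)$, so $\phi_x(t)=A^t+\sum_{s=0}^{t-1}A^{t-1-s}B\phi_u(s)$. Support constraints require a given set of entries of $\phi_u(t)$ ($0\le t\le T-1$) and a given set of entries of $\phi_x(t)$ ($1\le t\le T-1$) to be zero (such constraints arise from actuation delay, communication speed and locality restrictions). The system $S_c\vec\phi_u+C_c=0$ is the collection of scalar linear equations in $\phi_u$ consisting of these support constraints, with $\phi_x(t)$ expressed through $\phi_u$, together with all entries of the terminal constraint $\phi_x(T)=0$, i.e. $A^T+\sum_{s=0}^{T-1}A^{T-1-s}B\phi_u(s)=0$. Each scalar equation involves only entries of one $\Phi_i$; grouping the equations by $i$ gives the systems $S_i\Phi_i+C_i=0$. Thus $\omega_i$ is a particular solution of the $i$-th system and the columns of $V_i$ form a basis of $\ker S_i$. For $x_0\in\mathbb{R}^{N_x}$, $h_c(x_0)=\min_{\phi_u} x_0^\top\big(\sum_{t=0}^{T-1}\phi_u(t)^\top\phi_u(t)\big)x_0$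 subject to $S_c\vec\phi_u+C_c=0$, and the constrained controllability is $$Y_c=\mathrm{volume}\{A^Tx_0 : x_0\in\mathbb{R}^{N_x},\ h_c(x_0)\le 1\}.$$ Here $\mathrm{volume}$ is Lebesgue measure on $\mathbb{R}^{N_x}$ normalized so that the Euclidean unit ball has volume $1$.
   Formalization: The numerator det(A^T) is replaced by its absolute value |det(A^T)|, since the printed formula gives a negative volume when det(A^T) < 0; when the denominator vanishes (possible only for singular A), the quotient is read as 0, which is the true volume. *)

(* Defs.v *)
From HB Require Import structures.
From mathcomp Require Import all_boot all_order all_algebra.
From mathcomp Require Import all_classical all_reals all_analysis.
From mathcomp Require Import zify.
Set Implicit Arguments.
Unset Strict Implicit.
Unset Printing Implicit Defensive.
Import Order.TTheory GRing.Theory Num.Theory.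
Local Open Scope classical_set_scope.
Local Open Scope ring_scope.

(* The four Penrose equations; over a real field the adjoint is the
   transpose.  They have exactly one solution, so [mpinv M] never takes the
   default value 0. *)
Definition moore_penrose (R : realType) (m n : nat)
    (M : 'M[R]_(m, n)) (P : 'M[R]_(n, m)) : Prop :=
  [/\ M *m P *m M = M, P *m M *m P = P,
      (M *m P)^T = M *m P & (P *m M)^T = P *m M].

Definition mpinv (R : realType) (m n : nat) (M : 'M[R]_(m, n)) : 'M[R]_(n, m) :=
  xget 0 [set P | moore_penrose M P].

Definition sqnorm (R : realType) (n : nat) (v : 'cV[R]_n) : R :=
  \sum_(i < n) v i 0 ^+ 2.

Section Volume.
Context (R : realType) (n : nat).
Implicit Types (a b : 'cV[R]_n) (X : set 'cV[R]_n).

Definition box a b : set 'cV[R]_n :=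
  [set x | forall i, a i 0 <= x i 0 <= b i 0].

(* The truncation at 0 gives the empty boxes (b i < a i for some i) volume 0. *)
Definition box_volume a b : R := \prod_(i < n) Num.max 0 (b i 0 - a i 0).

(* n-dimensional Lebesgue measure, by the outer measure formula: the infimum
   of the total volumes of the countable covers by boxes.  On Lebesgue
   measurable sets this is the value of the Lebesgue measure. *)
Definition lebesgue X : \bar R :=
  ereal_inf
    [set (\sum_(0 <= k <oo) (box_volume (F k).1 (F k).2)%:E)%E
    | F in [set F : nat -> 'cV[R]_n * 'cV[R]_n |
            X `<=` \bigcup_k box (F k).1 (F k).2]].

(* Normalized so that the Euclidean unit ball, whose Lebesgue measure is
   positive and finite, has volume 1. *)
Definition volume X : \bar R :=
  (lebesgue X * ((fine (lebesgue [set x | sqnorm x <= 1]))^-1)%:E)%E.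

End Volume.

Section System.
Context (R : realType) (Nx Nu T : nat).
Variables (A : 'M[R]_Nx) (B : 'M[R]_(Nx, Nu)).
(* (j, i) \in Zu t: the entry (j, i) of phi_u(t) must vanish;
   (k, i) \in Zx t: the entry (k, i) of phi_x(t) must vanish, which is only
   required for 1 <= t <= T - 1. *)
Variables (Zu : 'I_T -> {set 'I_Nu * 'I_Nx}) (Zx : 'I_T -> {set 'I_Nx * 'I_Nx}).
Implicit Types phi : 'I_T -> 'M[R]_(Nu, Nx).

(* For t >= T (where phi_u(t) does not exist) the recursion reads 0 instead;
   [phi_x] is only used for t <= T. *)
Fixpoint phi_x phi (t : nat) : 'M[R]_Nx :=
  if t is s.+1 then A *m phi_x phi s + B *m oapp phi 0 (insub s) else 1%:M.

(* The whole system S_c phi + C_c = 0. *)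
Definition constraints phi : Prop :=
  [/\ forall t j i, (j, i) \in Zu t -> phi t j i = 0,
      forall (t : 'I_T) k i, (0 < t)%N -> (k, i) \in Zx t -> phi_x phi t k i = 0
    & phi_x phi T = 0].

Definition stack phi (i : 'I_Nx) : 'cV[R]_(\sum_(s < T) Nu) :=
  \mxcol_(s < T) col i (phi s).

(* The matrix of (phi_u(0), ..., phi_u(T-1)) |-> phi_x(t) - A ^+ t:
   its block s is A^(t-1-s) B for s < t and 0 for s >= t. *)
Definition input_to_state (t : nat) : 'M[R]_(Nx, \sum_(s < T) Nu) :=
  \mxrow_(s < T) (if (s < t)%N then A ^+ (t - 1 - s) *m B else 0).

(* 0/1 diagonal matrices selecting the entries of the i-th columns of
   phi_u(t) and phi_x(t) that are required to vanish; at t = T this is every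
   entry of phi_x(T). *)
Definition mask_u (i : 'I_Nx) (t : 'I_T) : 'M[R]_Nu :=
  diag_mx (\row_(j < Nu) ((j, i) \in Zu t)%:R).

Definition constrained_x (t : nat) (k i : 'I_Nx) : bool :=
  if insub t is Some t' then (0 < t)%N && ((k, i) \in Zx t') else t == T.

Definition mask_x (i : 'I_Nx) (t : nat) : 'M[R]_Nx :=
  diag_mx (\row_(k < Nx) (constrained_x t k i)%:R).

(* The equations on the i-th columns, S_i Phi_i + C_i = 0.  Entries that are
   not constrained contribute the void equation 0 = 0. *)
Definition S_col (i : 'I_Nx) :
    'M[R]_(\sum_(t < T) Nu + \sum_(t < T.+1) Nx, \sum_(s < T) Nu) :=
  col_mx (\mxdiag_(t < T) mask_u i t)
         (\mxcol_(t < T.+1) (mask_x i t *m input_to_state t)).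

Definition C_col (i : 'I_Nx) : 'cV[R]_(\sum_(t < T) Nu + \sum_(t < T.+1) Nx) :=
  col_mx 0 (\mxcol_(t < T.+1) (mask_x i t *m col i (A ^+ t))).

Lemma phi_xE phi (t : nat) (i : 'I_Nx) : (t <= T)%N ->
  col i (phi_x phi t) = col i (A ^+ t) + input_to_state t *m stack phi i.
Proof.
elim: t => [_|t IHt lt_tT] /=.
  rewrite expr0 /input_to_state /stack mul_mxrow_mxcol big1 ?addr0// => s _.
  by rewrite mul0mx.
rewrite insubT /=; have colM m n (X : 'M[R]_(m, n)) (Y : 'M[R]_(n, Nx)) :
  col i (X *m Y) = X *m col i Y by rewrite !colE mulmxA.
rewrite colE mulmxDl -!colE !colM IHt ?(ltnW lt_tT)// mulmxDr -colM exprS.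
rewrite -addrA; congr (_ + _); first by rewrite -colM.
rewrite /input_to_state /stack !mul_mxrow_mxcol mulmx_sumr.
rewrite (bigD1 (Ordinal lt_tT))//= [RHS](bigD1 (Ordinal lt_tT))//= ltnn ltnSn.
have -> : (t.+1 - 1 - t = 0)%N by lia.
rewrite mul0mx mulmx0 add0r expr0 mul1mx addrC -colM; congr (_ + _).
apply: eq_bigr => s neq_st.
have -> : (s < t.+1)%N = (s < t)%N.
  by rewrite ltnS leq_eqVlt (negbTE neq_st : (s == t :> nat) = false).
case: ifP => /= [lt_st|_]; last by rewrite !mul0mx mulmx0.
have -> : (t.+1 - 1 - s = (t - 1 - s).+1)%N by lia.
by rewrite exprS !mulmxA.
Qed.

Lemma constraintsE phi :
  constraints phi <-> forall i, S_col i *m stack phi i + C_col i = 0.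
Proof.
have maskE n (f : 'I_n -> bool) (v : 'cV[R]_n) :
    diag_mx (\row_k (f k)%:R) *m v = 0 <-> forall k, f k -> v k 0 = 0.
  split=> [+ k fk|fv].
    by move=> /colP/(_ k); rewrite mul_diag_mx !mxE fk mul1r.
  apply/colP => k; rewrite mul_diag_mx !mxE.
  by case: (boolP (f k)) => [/fv->|]; rewrite ?mulr0 ?mul0r.
have rowsE i : S_col i *m stack phi i + C_col i = 0 <->
    (forall t : 'I_T, mask_u i t *m col i (phi t) = 0) /\
    (forall t : 'I_T.+1, mask_x i t *m col i (phi_x phi t) = 0).
  rewrite /S_col /C_col mul_col_mx add_col_mx addr0 -col_mx0.
  rewrite {1}/stack mul_mxdiag_mxcol mxcol_mul -mxcolD -!mxcol0.
  split=> [/eq_col_mx[/eq_mxcolP Hu /eq_mxcolP Hx]|[Hu Hx]].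
    split=> t; first exact: Hu.
    by rewrite phi_xE -1?ltnS// mulmxDr addrC mulmxA Hx.
  congr col_mx; apply/eq_mxcolP => t; first exact: Hu.
  by rewrite -mulmxA -mulmxDr addrC -phi_xE -1?ltnS.
split=> [[Hu Hx HT] i|H].
  apply/rowsE; split=> t; apply/maskE => k; rewrite mxE; first exact: Hu.
  rewrite /constrained_x; case: insubP => [t' _ <- /andP[]|_ /eqP->].
    exact: Hx.
  by rewrite HT mxE.
have {}H i := (rowsE i).1 (H i).
split=> [t j i jiZ|t k i t0 kiZ|].
- by have /maskE/(_ j jiZ) := (H i).1 t; rewrite mxE.
- have /maskE/(_ k) := (H i).2 (widen_ord (leqnSn T) t).
  rewrite /constrained_x /= insubT // => ltT.
  by rewrite mxE; apply; rewrite t0/=; congr (_ \in Zx _): kiZ; exact: val_inj.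
- apply/matrixP => k i; rewrite [RHS]mxE.
  have /maskE/(_ k) := (H i).2 ord_max.
  by rewrite /constrained_x /= insubF ?ltnn// eqxx mxE; apply.
Qed.

Definition cost phi (x0 : 'cV[R]_Nx) : R :=
  (x0^T *m (\sum_(t < T) (phi t)^T *m phi t) *m x0) 0 0.

(* The minimum, i.e. the lower bound that is attained; it exists for every x0
   as soon as the constraints are solvable. *)
Definition h_c (x0 : 'cV[R]_Nx) : R :=
  let E := [set cost phi x0 | phi in [set phi | constraints phi]] in
  xget 0 [set m | E m /\ lbound E m].

Definition Y_c : \bar R :=
  volume [set A ^+ T *m x0 | x0 in [set x0 | h_c x0 <= 1]].

End System.

(* Main.v *)
Require Import Defs.
From HB Require Import structures.
From mathcomp Require Import all_boot all_order all_algebra.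
From mathcomp Require Import all_classical all_reals all_analysis.
From mathcomp Require Import measurable_realfun ring lra zify.
Set Implicit Arguments.
Unset Strict Implicit.
Unset Printing Implicit Defensive.
Import Order.TTheory GRing.Theory Num.Theory.
Local Open Scope classical_set_scope.
Local Open Scope ring_scope.

(** Why the theorem is true.  If a feasible controller has columns
    omega_i + V_i lambda_i, the stacked control it applies from x0 is
    N x0 + sum_i x0_i V_i lambda_i.  When no coordinate of x0 vanishes, the
    coefficients x0_i lambda_i are arbitrary, so this vector ranges over the
    whole affine space N x0 + range M, whose shortest vector is
    W x0 = N x0 - M M^+ N x0 ([sqnorm_least_squares]); hence
    h_c x0 = |W x0|^2 ([h_c_generic]).  When some x0_i is zero the
    corresponding columns of M cannot be used and only h_c x0 >= |W x0|^2
    survives ([h_c_ge]).  The two sublevel sets therefore agree outside the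
    coordinate hyperplanes, and their images under G = A^T agree outside a
    Lebesgue null set.

    For the closed formula, the terminal constraint G + C phi = 0, with C the
    matrix from inputs to the final state, gives C N = - G and C M = 0, so
    that W x = 0 forces G x = 0 ([ker_W]).  If G is invertible, W^T W is then
    positive definite and factors as P^T P ([cholesky]); the set in question
    is the image of the unit ball under G P^-1, and a linear map multiplies
    the measure by |det| ([lebesgue_image]).  If G is singular, both images lie
    in a proper subspace and both sides are 0, whatever W^T W is.

    The measure theory is built from the outer measure formula.  Countable
    subadditivity reduces the bound lebesgue (P X) <= |det P| lebesgue X to
    boxes, multiplicativity of the determinant reduces it to the factors of P
    given by Gaussian elimination, and a shear of a box is treated by cutting
    the box into thin slabs.  The reverse inequality is the same bound for
    P^-1.  That the unit ball has positive measure, which makes the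
    normalization meaningful, is the lower bound [box_volume_le_cover] on the
    covers of a box, proved by integrating over slices. *)

(** * The outer measure *)

Section OuterMeasure.
Context (R : realType) (n : nat).
Implicit Types (a b : 'cV[R]_n) (X Y : set 'cV[R]_n).

Lemma box_volume_ge0 a b : 0 <= box_volume a b.
Proof. by apply: prodr_ge0 => i _; rewrite le_max lexx. Qed.

Lemma lebesgue_ge0 X : (0 <= lebesgue X)%E.
Proof.
apply: le_ereal_inf_tmp => _ [F _ <-]; apply: nneseries_ge0 => k _ _.
by rewrite lee_fin box_volume_ge0.
Qed.

Lemma lebesgue_le X Y : X `<=` Y -> (lebesgue X <= lebesgue Y)%E.
Proof.
move=> XY; apply: ereal_inf_le_tmp => _ [F YF <-]; exists F => //.
exact: subset_trans YF.
Qed.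

Lemma lebesgue_le_cover X (F : nat -> 'cV[R]_n * 'cV[R]_n) :
  X `<=` \bigcup_k box (F k).1 (F k).2 ->
  (lebesgue X <= \sum_(0 <= k <oo) (box_volume (F k).1 (F k).2)%:E)%E.
Proof. by move=> XF; apply: ereal_inf_lbound; exists F. Qed.

(** Covers F k of the X k with total volume at most e / 2^(k+1) above
    lebesgue (X k) are interleaved into a single cover along a bijection
    between nat and nat * nat. *)
Lemma lebesgue_bigcup (X : nat -> set 'cV[R]_n) :
  (lebesgue (\bigcup_k X k) <= \sum_(0 <= k <oo) lebesgue (X k))%E.
Proof.
have [[k Xk]|/forallNP Xfin] := pselect (exists k, lebesgue (X k) = +oo%E).
  rewrite (@nneseries_pinfty _ _ _ k) ?leey// => j _.
  exact: lebesgue_ge0.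
apply/lee_addgt0Pr => e e0.
apply: le_trans (epsilon_trick _ (fun k => lebesgue_ge0 (X k)) (ltW e0)).
pose vol (F : nat -> 'cV[R]_n * 'cV[R]_n) k := (box_volume (F k).1 (F k).2)%:E.
have vol0 F k : (0 <= vol F k)%E by rewrite lee_fin box_volume_ge0.
have /choice[F FP] k : exists F : nat -> 'cV[R]_n * 'cV[R]_n,
    X k `<=` \bigcup_l box (F l).1 (F l).2 /\
    (\sum_(0 <= l <oo) vol F l <= lebesgue (X k) + (e / (2 ^ k.+1)%:R)%:E)%E.
  have Xk : lebesgue (X k) \is a fin_num.
    by rewrite ge0_fin_numE ?lebesgue_ge0// ltey; apply/eqP/Xfin.
  have ek : 0 < e / (2 ^ k.+1)%:R :> R by rewrite divr_gt0// ltr0n expn_gt0.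
  have [_ [F XF <-] /ltW Fle] := lb_ereal_inf_adherent ek Xk.
  by exists F.
apply: le_trans (lee_nneseries _ (fun k _ => (FP k).2)); last first.
  by move=> k _ _; exact: nneseries_ge0.
have /card_esym/ppcard_eqP[f] := card_nat2.
pose G m := F (f m).1 (f m).2.
have XG : \bigcup_k X k `<=` \bigcup_m box (G m).1 (G m).2.
  move=> x [k _ /(FP k).1[l _ xFkl]]; exists (f^-1%FUN (k, l)) => //.
  by rewrite /G invK ?inE.
apply: le_trans (lebesgue_le_cover XG) _.
rewrite [leRHS](_ : _ = \esum_(p in setT) vol (F p.1) p.2)%E; last first.
  rewrite nneseries_esumT; last by move=> k; exact: nneseries_ge0.
  under eq_esum do rewrite nneseries_esumT//.
  by rewrite esum_esum//; congr esum; apply/seteqP.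
rewrite nneseries_esumT => [|m]; last exact: vol0.
by rewrite (reindex_esum [set: nat] _ f (fun p => vol (F p.1) p.2)).
Qed.

(* In dimension 0 every box has volume 1; null boxes, which pad the finite
   covers into sequences, need a coordinate. *)
Hypothesis n_gt0 : (0 < n)%N.

Lemma box_volume00 : box_volume (0 : 'cV[R]_n) 0 = 0.
Proof.
rewrite /box_volume (bigD1 (Ordinal n_gt0))//= mxE subrr maxxx.
by rewrite mul0r.
Qed.

Lemma lebesgue_box_le a b : (lebesgue (box a b) <= (box_volume a b)%:E)%E.
Proof.
pose F k := if k == 0%N then (a, b) else (0, 0).
have abF : box a b `<=` \bigcup_k box (F k).1 (F k).2.
  by move=> x abx; exists 0%N.
apply: le_trans (lebesgue_le_cover abF) _.
rewrite (@nneseries_split _ _ 0 1) => [|k _]; last first.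
  by rewrite lee_fin box_volume_ge0.
rewrite big_nat1 eseries0 ?adde0// => k k1 _ /=.
by rewrite /F gtn_eqF//= box_volume00.
Qed.

Lemma lebesgue0 : lebesgue (set0 : set 'cV[R]_n) = 0%E.
Proof.
apply/eqP; rewrite eq_le lebesgue_ge0 andbT -[leRHS]/(0%:E) -box_volume00.
exact: le_trans (lebesgue_le (@sub0set _ _)) (lebesgue_box_le _ _).
Qed.

Lemma lebesgueU X Y : (lebesgue (X `|` Y) <= lebesgue X + lebesgue Y)%E.
Proof.
rewrite -bigcup2E; apply: le_trans (lebesgue_bigcup _) _.
rewrite (@nneseries_split _ _ 0 2) => [|k _]; last exact: lebesgue_ge0.
rewrite add0n big_ltn// big_nat1 /bigcup2 /=.
rewrite eseries0 ?adde0// => k k1 _ /=.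
by rewrite /bigcup2; case: k k1 => [|[|k]]//= _; rewrite lebesgue0.
Qed.

End OuterMeasure.

(** * Volume of boxes *)

Section BoxLowerBound.
Context (R : realType).

(** Covers of a box are not too small.  By induction on the dimension: the
    slice of the cover at first coordinate t covers the slice of the box, so
    its total volume is at least that of the slice; integrating this over t
    and exchanging sum and integral gives the claim.  The predicate D selects
    the boxes in use, since only those whose first side contains t meet the
    slice. *)
Lemma box_volume_le_cover n (a b : 'cV[R]_n) (D : nat -> bool)
    (F : nat -> 'cV[R]_n * 'cV[R]_n) :
  (forall x, box a b x -> exists2 k, D k & box (F k).1 (F k).2 x) ->
  ((box_volume a b)%:E <=
   \sum_(0 <= k <oo) (if D k then box_volume (F k).1 (F k).2 else 0)%:E)%E.
Proof.
elim: n a b D F => [|n IHn] a b D F abF.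
  (* In dimension 0 the only point has to be covered, by a box of volume 1. *)
  have [|k Dk _] := abF 0; first by case.
  have t0 j : (0%E <= (if D j then box_volume (F j).1 (F j).2 else 0)%:E)%E.
    by case: ifP => _; rewrite lee_fin ?box_volume_ge0.
  apply: (le_trans _ (nneseries_lim_ge k.+1 (fun j _ _ => t0 j))).
  rewrite big_nat_recr//= Dk /box_volume !big_ord0.
  rewrite leeDr//; apply: sume_ge0 => j _; exact: t0.
pose tl (c : 'cV[R]_n.+1) : 'cV[R]_n := \col_i c (lift ord0 i) 0.
have volE c d : box_volume c d =
    Num.max 0 (d 0 0 - c 0 0) * box_volume (tl c) (tl d).
  rewrite /box_volume big_ord_recl; congr (_ * _).
  by apply: eq_bigr => i _; rewrite !mxE.
have sliceE (c d : 'cV[R]_n.+1) (t : R) (y : 'cV[R]_n) :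
    box c d (\col_i oapp (fun j => y j 0) t (unlift ord0 i)) <->
    c 0 0 <= t <= d 0 0 /\ box (tl c) (tl d) y.
  split=> [cd|[ct cd] i].
    split=> [|i]; first by have := cd 0; rewrite mxE unlift_none.
    by have := cd (lift ord0 i); rewrite !mxE liftK.
  rewrite mxE; case: unliftP => [j ->|->] //=.
  by have := cd j; rewrite !mxE.
have [ab0|/ltW ab0] := leP (b 0 0) (a 0 0).
  rewrite volE max_l ?subr_le0// mul0r nneseries_ge0// => k _ _.
  by case: ifP => _; rewrite lee_fin ?box_volume_ge0.
(* h k t is the volume of the slice of F k at t, as a function of t. *)
pose g k (t : R) : R := box_volume (tl (F k).1) (tl (F k).2) *
  \1_(`[(F k).1 0 0, (F k).2 0 0]) t.
pose h k (t : R) : R := if D k then g k t else 0.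
have h0 k t : 0 <= h k t.
  by rewrite /h; case: ifP => // _; rewrite mulr_ge0 ?box_volume_ge0.
have mh k :
    measurable_fun (`[a 0 0, b 0 0]%classic : set (measurableTypeR R))
      (h k : _ -> measurableTypeR R).
  rewrite /h; case: (D k); last exact: measurable_cst.
  apply: measurable_funM => //; exact: measurable_indic.
have slice t : `[a 0 0, b 0 0]%classic t ->
    ((box_volume (tl a) (tl b))%:E <= \sum_(0 <= k <oo) (h k t)%:E)%E.
  rewrite /= in_itv/= => abt.
  apply: (le_trans (IHn _ _
    (fun k => D k && ((F k).1 0 0 <= t <= (F k).2 0 0))
    (fun k => (tl (F k).1, tl (F k).2)) _)) => /=.
    move=> y aby; have [k Dk] := abF _ ((sliceE a b t y).2 (conj abt aby)).
    by move=> /sliceE[Fkt Fky]; exists k; rewrite ?Dk.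
  apply: lee_nneseries => [k _ _|k _].
    by case: ifP => _; rewrite lee_fin ?box_volume_ge0.
  rewrite lee_fin /h /g indicE; case: (D k) => //=.
  rewrite mem_setE in_itv/=; case: ifP; first by rewrite mulr1.
  by rewrite mulr0.
have measure_itv (c d : R) :
    lebesgue_measure `[c, d]%classic = (Num.max 0 (d - c))%:E.
  rewrite lebesgue_measure_itv/= lte_fin; case: ltP => [lt|ge].
    by rewrite max_r ?subr_ge0 1?ltW.
  by rewrite max_l ?subr_le0.
have mI : measurable (`[a 0 0, b 0 0]%classic : set R) by [].
apply: (@le_trans _ _ (\int[lebesgue_measure]_(t in `[a 0%R 0%R, b 0%R 0%R])
    (box_volume (tl a) (tl b))%:E)%E).
  by rewrite integral_cst// [X in (_ * X)%E]measure_itv -EFinM volE mulrC.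
apply: (@le_trans _ _ (\int[lebesgue_measure]_(t in `[a 0%R 0%R, b 0%R 0%R])
    \sum_(0 <= k <oo) (h k t)%:E)%E).
  apply: ge0_le_integral => //.
  - by move=> t _; rewrite lee_fin box_volume_ge0.
  - apply: (ge0_emeasurable_sum (h := fun k t => (h k t)%:E) (P := xpredT)).
      by move=> k t _ _; exact: (h0 k t).
    by move=> k _; exact: (iffRL (measurable_EFinP _ (h k)) (mh k)).
rewrite integral_nneseries//=; last first.
- by move=> k t _; exact: h0.
- by move=> k; exact: (iffRL (measurable_EFinP _ (h k)) (mh k)).
apply: lee_nneseries => [k _ _|k _].
  by apply: integral_ge0 => t _; exact: h0.
rewrite /h; case: (D k); last by rewrite integral0.
rewrite /g; under eq_integral do rewrite EFinM.
rewrite ge0_integralZl//; last 2 first.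
- by apply: (iffRL (measurable_EFinP _ _)); exact: measurable_indic.
- by rewrite lee_fin box_volume_ge0.
rewrite integral_indic// volE mulrC EFinM lee_wpmul2l//.
  by rewrite lee_fin box_volume_ge0.
apply: (@le_trans _ _ (lebesgue_measure `[(F k).1 0 0, (F k).2 0 0]%classic)).
  by apply: le_measure; rewrite ?inE//; exact: measurableI.
by rewrite measure_itv. 
Qed.

Lemma lebesgue_box n (a b : 'cV[R]_n) : (0 < n)%N ->
  lebesgue (box a b) = (box_volume a b)%:E.
Proof.
move=> n0; apply/eqP; rewrite eq_le lebesgue_box_le//=.
apply: le_ereal_inf_tmp => _ [F abF <-].
apply: le_trans (@box_volume_le_cover _ _ _ xpredT F _) _ => [x /abF[k _ ?]|//].
by exists k.
Qed.

End BoxLowerBound.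

(** * Gaussian elimination *)

(** Row exchanges are absent: they are products of the generators below. *)
Inductive elementary_product (F : fieldType) (n : nat) : 'M[F]_n -> Prop :=
| Diagonal d : elementary_product (diag_mx d)
| Transvection i j c of i != j : elementary_product (1%:M + c *: delta_mx i j)
| Product P Q of elementary_product P & elementary_product Q :
    elementary_product (P *m Q).

Section Elimination.
Context (F : fieldType).

Lemma elementary_product1 n : elementary_product (1%:M : 'M[F]_n).
Proof. by rewrite -diag_const_mx; exact: Diagonal. Qed.

Lemma elementary_product_tr n (P : 'M[F]_n) :
  elementary_product P -> elementary_product P^T.
Proof.
elim=> {P} [d|i j c neq_ij|P Q _ IHP _ IHQ].
- by rewrite tr_diag_mx; exact: Diagonal.
- rewrite linearD linearZ /= trmx_delta trmx1; apply: Transvection.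
  by rewrite eq_sym.
- by rewrite trmx_mul; exact: Product.
Qed.

(** Each generator of size n extended by 1 is a generator of size n + 1;
    this is how the Schur complement is handled in the induction. *)
Lemma elementary_product_lift n (D : 'M[F]_n) : elementary_product D ->
  elementary_product (block_mx (1%:M : 'M[F]_1) 0 0 D).
Proof.
elim=> {D} [d|i j c neq_ij|P Q _ IHP _ IHQ].
- by rewrite -diag_const_mx -diag_mx_row; exact: Diagonal.
- rewrite [X in elementary_product X](_ : _ =
      1%:M + c *: delta_mx (rshift 1 i) (rshift 1 j)); last first.
    rewrite delta_mx_rshift delta_mx_dshift.
    rewrite [X in row_mx X _](esym (col_mx0 _ _ _ _)).
    rewrite -block_mxEh scalar_mx_block scale_block_mx add_block_mx.
    by rewrite !scaler0 !addr0.
  by apply: Transvection; rewrite (inj_eq (@rshift_inj _ _)).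
- rewrite [X in elementary_product X](_ : _ =
      block_mx (1%:M : 'M[F]_1) 0 0 P *m block_mx (1%:M : 'M[F]_1) 0 0 Q).
    exact: Product.
  by rewrite mulmx_block !mulmx0 !mul0mx !addr0 add0r mulmx1.
Qed.

Lemma elementary_product_col n (c : 'cV[F]_n) :
  elementary_product (block_mx (1%:M : 'M[F]_1) 0 c 1%:M).
Proof.
rewrite (matrix_sum_delta c); under eq_bigr do rewrite big_ord1.
apply: (big_ind (fun c =>
  elementary_product (block_mx (1%:M : 'M[F]_1) 0 c 1%:M))) => [|x y Px Py|i _].
- by rewrite -scalar_mx_block; exact: elementary_product1.
- rewrite [X in elementary_product X](_ : _ =
      block_mx (1%:M : 'M[F]_1) 0 x 1%:M *m block_mx (1%:M : 'M[F]_1) 0 y 1%:M).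
    exact: Product.
  by rewrite mulmx_block !mulmx0 !mul0mx !mulmx1 !mul1mx !addr0 add0r.
- rewrite [X in elementary_product X](_ : _ =
      1%:M + c i 0 *: delta_mx (rshift 1 i) (lshift n 0)); last first.
    rewrite delta_mx_lshift delta_mx_dshift.
    rewrite [X in row_mx _ X](esym (col_mx0 _ _ _ _)).
    rewrite -block_mxEh scalar_mx_block scale_block_mx add_block_mx.
    by rewrite !scaler0 !addr0 add0r.
  by apply: Transvection; rewrite eq_sym eq_lrshift.
Qed.

Lemma elementary_product_row n (b : 'rV[F]_n) :
  elementary_product (block_mx (1%:M : 'M[F]_1) b 0 1%:M).
Proof.
have := elementary_product_tr (elementary_product_col b^T).
by rewrite tr_block_mx !trmx1 trmx0 trmxK.
Qed.

(** Gaussian elimination.  If the first column is zero below the corner, the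
    matrix is a product of a lifted matrix, a row clearing and a diagonal; a
    nonzero corner clears the column below it; and a zero corner above a
    nonzero entry is made nonzero by adding the row of that entry. *)
Lemma elementary_productP n (P : 'M[F]_n) : elementary_product P.
Proof.
elim: n P => [|n IHn] P.
  by rewrite [P]thinmx0 -(thinmx0 1%:M); exact: elementary_product1.
have clear_col (a : 'M[F]_1) b D :
    elementary_product (block_mx a b 0 D : 'M[F]_(1 + n)).
  have -> : block_mx a b 0 D = block_mx 1%:M 0 0 D *m
      (block_mx 1%:M b 0 1%:M *m diag_mx (row_mx a (const_mx 1))).
    rewrite diag_mx_row diag_const_mx !mulmx_block !mulmx0 !mul0mx.
    rewrite !mulmx1 !mul1mx !addr0 !add0r mulmx1; congr block_mx; last by rewrite mulmx0.
    by apply/matrixP => i j; rewrite !ord1 !mxE eqxx mulr1n.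
  apply: Product; first exact: elementary_product_lift.
  by apply: Product; [exact: elementary_product_row|exact: Diagonal].
pose z : 'I_(1 + n) := lshift n 0.
have pivot (P' : 'M[F]_(1 + n)) : P' z z != 0 -> elementary_product P'.
  rewrite -[P']submxK; set a := ulsubmx _; set b := ursubmx _.
  set c := dlsubmx _; set D := drsubmx _.
  rewrite /z block_mxEul => a0.
  have -> : block_mx a b c D = block_mx 1%:M 0 ((a 0 0)^-1 *: c) 1%:M *m
      block_mx a b 0 (D - (a 0 0)^-1 *: c *m b).
    rewrite mulmx_block !mul1mx !mul0mx !addr0; congr block_mx; last first.
      by rewrite addrC subrK.
    by rewrite [X in _ *m X]mx11_scalar mul_mx_scalar scalerA mulfV// scale1r.
  by apply: Product; [exact: elementary_product_col|exact: clear_col].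
have [P00|/pivot//] := eqVneq ((P : 'M[F]_(1 + n)) z z) 0.
have [/existsP[i Pi0]|/existsPn P0] :=
  boolP [exists i, (P : 'M[F]_(1 + n)) i z != 0].
  have i0 : z != i by apply: contraNneq Pi0 => <-; rewrite P00.
  have -> : P = (1%:M + (-1) *: delta_mx z i) *m
      ((1%:M + 1 *: delta_mx z i) *m P).
    rewrite mulmxA !scale1r scaleN1r mulmxDl !mulmxDr !mul1mx !mulmx1 mulNmx.
    rewrite mul_delta_mx_0 1?eq_sym//.
    by rewrite oppr0 addr0 addrK mul1mx.
  apply: Product; first exact: Transvection.
  apply: (pivot ((1%:M + 1 *: delta_mx z i) *m P)).
  rewrite scale1r mulmxDl mul1mx mxE P00 add0r mxE (bigD1 i)//= mxE !eqxx mul1r.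
  rewrite big1 ?addr0// => k ki; by rewrite mxE (negPf ki) andbF mul0r.
rewrite -[P](@submxK _ 1 n 1 n).
rewrite [X in block_mx _ _ X _](_ : _ = 0); first exact: clear_col.
apply/matrixP => i j; rewrite !mxE ord1.
exact: (eqP (negbNE (P0 _))).
Qed.

Lemma det_transvection n (i j : 'I_n) (c : F) :
  i != j -> \det (1%:M + c *: delta_mx i j) = 1.
Proof.
wlog lt_ji : i j / (j < i)%N => [IH neq_ij|neq_ij].
  have := neq_ij; rewrite -(inj_eq val_inj) neq_ltn => /orP[lt|lt].
    2: exact: IH.
  rewrite -det_tr linearD linearZ /= trmx_delta trmx1; apply: IH => //.
  by rewrite eq_sym.
rewrite det_trig.
  rewrite big1// => k _; rewrite !mxE eqxx.
  have [->|_] := eqVneq k i; last by rewrite mulr0 addr0.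
  by rewrite (negPf neq_ij) mulr0 addr0.
apply/is_trig_mxP => k l lt_kl; rewrite !mxE.
have -> : (k == l) = false by rewrite -(inj_eq val_inj) ltn_eqF.
rewrite add0r; case: andP => [[/eqP ki /eqP lj]|_]; last by rewrite mulr0.
by move: lt_kl lt_ji; rewrite ki lj; lia.
Qed.
End Elimination.

(** * Images under linear maps *)

Section LinearImage.
Context (R : realType) (n : nat).
Hypothesis n_gt0 : (0 < n)%N.
Implicit Types (a b : 'cV[R]_n) (X : set 'cV[R]_n) (P Q : 'M[R]_n).

Definition scales_boxes_le P := forall a b,
  (lebesgue [set P *m x | x in box a b] <= (`|\det P| * box_volume a b)%:E)%E.

Lemma box_cover_setT : exists F : nat -> 'cV[R]_n * 'cV[R]_n,
  setT `<=` \bigcup_k box (F k).1 (F k).2.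
Proof.
exists (fun k => (const_mx (- k%:R), const_mx k%:R)) => x _.
exists (Num.bound (\sum_i `|x i 0|)) => // i.
rewrite !mxE -ler_norml; apply/ltW/(le_lt_trans _ (archi_boundP _)).
  by rewrite (bigD1 i)//= lerDl sumr_ge0.
exact: sumr_ge0.
Qed.

Lemma lebesgue_image_cover P X (F : nat -> 'cV[R]_n * 'cV[R]_n) :
  scales_boxes_le P -> X `<=` \bigcup_k box (F k).1 (F k).2 ->
  (lebesgue [set P *m x | x in X] <=
   `|\det P|%:E * \sum_(0 <= k <oo) (box_volume (F k).1 (F k).2)%:E)%E.
Proof.
move=> PP XF; rewrite -nneseriesZl => [|k _]; last first.
  by rewrite lee_fin box_volume_ge0.
apply: (@le_trans _ _ (\sum_(0 <= k <oo)
    lebesgue [set P *m x | x in box (F k).1 (F k).2])%E); last first.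
  by apply: lee_nneseries => [k _ _|k _]; [exact: lebesgue_ge0|exact: PP].
apply: le_trans (lebesgue_bigcup _); apply: lebesgue_le.
by move=> _ [x /XF[k _ Fkx] <-]; exists k => //; exists x.
Qed.

(** A singular P is treated apart, because the product of 0 with the infimum
    over covers is not an infimum of products: a single cover suffices. *)
Lemma lebesgue_image_le_of P X : scales_boxes_le P ->
  (lebesgue [set P *m x | x in X] <= `|\det P|%:E * lebesgue X)%E.
Proof.
move=> PP; have [P0|P0] := eqVneq (\det P) 0.
  have [F TF] := box_cover_setT.
  have := lebesgue_image_cover PP (subset_trans (@subsetT _ X) TF).
  by rewrite P0 normr0 !mul0e.
rewrite -ereal_inf_pZl ?normr_gt0//.
apply: le_ereal_inf_tmp => _ [_ [F XF <-] <-].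
exact: lebesgue_image_cover.
Qed.

Lemma scales_boxes_leM P Q :
  scales_boxes_le P -> scales_boxes_le Q -> scales_boxes_le (P *m Q).
Proof.
move=> PP PQ a b; rewrite det_mulmx normrM -mulrA EFinM.
have -> : [set P *m Q *m x | x in box a b] =
    [set P *m y | y in [set Q *m x | x in box a b]].
  rewrite image_comp; apply/seteqP; split=> _ [x abx <-]; exists x => //=;
  by rewrite mulmxA.
apply: le_trans (lebesgue_image_le_of _ PP) _.
by apply: lee_wpmul2l; rewrite ?lee_fin.
Qed.

(** The image of a box is a box with sides multiplied by the |d i|.  It is
    written with its center c and half-sides e to avoid splitting on the
    signs of the d i. *)
Lemma scales_boxes_le_diag (d : 'rV[R]_n) : scales_boxes_le (diag_mx d).
Proof.
move=> a b; pose c : 'cV[R]_n := \col_i (d 0 i * (a i 0 + b i 0) / 2).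
pose e : 'cV[R]_n := \col_i (`|d 0 i| * (Num.max 0 (b i 0 - a i 0)) / 2).
apply: (@le_trans _ _ (lebesgue (box (c - e) (c + e)))).
  apply: lebesgue_le => _ [x abx <-] i; rewrite mul_diag_mx !mxE.
  have /andP[ax xb] := abx i.
  rewrite max_r ?subr_ge0 ?(le_trans ax)//.
  rewrite -ler_distlC distrC.
  have -> : d 0 i * x i 0 - d 0 i * (a i 0 + b i 0) / 2 =
            d 0 i * ((x i 0 - a i 0) - (b i 0 - x i 0)) / 2 by field.
  rewrite !normrM [`|2^-1|]ger0_norm ?invr_ge0// ler_wpM2r ?invr_ge0//.
  by rewrite ler_wpM2l// ler_norml; apply/andP; split; lra.
apply: le_trans (lebesgue_box_le n_gt0 _ _) _.
rewrite lee_fin det_diag normr_prod -big_split/=.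
rewrite le_eqVlt; apply/orP; left; apply/eqP/eq_bigr => i _.
rewrite !mxE.
set m := Num.max 0 (b i 0 - a i 0).
have m0 : 0 <= `|d 0 i| * m by rewrite mulr_ge0// le_max lexx.
have -> : d 0 i * (a i 0 + b i 0) / 2 + `|d 0 i| * m / 2 -
  (d 0 i * (a i 0 + b i 0) / 2 - `|d 0 i| * m / 2) = `|d 0 i| * m by field.
by rewrite max_r.
Qed.

Lemma transvectionE (i j k : 'I_n) (c : R) (x : 'cV[R]_n) :
  ((1%:M + c *: delta_mx i j) *m x) k 0 = x k 0 + (k == i)%:R * c * x j 0.
Proof.
rewrite mulmxDl mul1mx mxE; congr (_ + _).
rewrite -scalemxAl mxE -mulrA mulrCA; congr (_ * _).
rewrite mxE (bigD1 j)//= mxE eqxx andbT big1 ?addr0// => l lj.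
by rewrite mxE (negPf lj) andbF mul0r.
Qed.

Let len a b i := Num.max 0 (b i 0 - a i 0).

(** A shear moves the side i of the box by c times the coordinate j, so a
    bounding box of the image has side i longer by 2 |c| len j.  Halving the
    side j cuts the image into two pieces for which this excess is halved;
    after p halvings it is divided by 2^p. *)
Lemma lebesgue_transvection_approx (i j : 'I_n) (c : R) (p : nat) a b :
  i != j ->
  (lebesgue [set (1%:M + c *: delta_mx i j) *m x | x in box a b] <=
   (\prod_(k | k != i) len a b k *
    (len a b i + 2 * `|c| * len a b j / 2 ^+ p))%:E)%E.
Proof.
move=> neq_ij; elim: p a b => [|p IHp] a b.
  pose e := `|c| * len a b j.
  pose a' : 'cV[R]_n := \col_k (a k 0 + (k == i)%:R * (c * a j 0 - e)).
  pose b' : 'cV[R]_n := \col_k (b k 0 + (k == i)%:R * (c * a j 0 + e)).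
  have e0 : 0 <= e by rewrite mulr_ge0// le_max lexx.
  apply: (@le_trans _ _ (lebesgue (box a' b'))).
    apply: lebesgue_le => _ [x abx <-] k; rewrite transvectionE !mxE.
    have /andP[ax xb] := abx k; have /andP[axj xbj] := abx j.
    have [ki|_] := eqVneq k i; last by rewrite !mul0r !addr0 ax.
    have : `|c * (x j 0 - a j 0)| <= e.
      rewrite normrM ler_wpM2l// /len max_r ?subr_ge0 ?(le_trans axj)//.
      by rewrite ger0_norm ?subr_ge0// lerD2r.
    rewrite ler_norml !mul1r mulrBr => /andP[]; lra.
  apply: le_trans (lebesgue_box_le n_gt0 _ _) _.
  rewrite lee_fin /box_volume (bigD1 i)//= mulrC expr0 divr1.
  rewrite [X in X * _ <= _](_ : _ = \prod_(k | k != i) len a b k); last first.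
    by apply: eq_bigr => k ki; rewrite !mxE (negPf ki) !mul0r !addr0.
  apply: ler_wpM2l; first by apply: prodr_ge0 => k _; rewrite le_max lexx.
  rewrite !mxE eqxx !mul1r ge_max -mulrA -/e; apply/andP; split.
    by rewrite addr_ge0// ?le_max ?lexx// mulr_ge0.
  have : b i 0 - a i 0 <= len a b i by rewrite le_max lexx orbT.
  by lra.
have [ab_j|ba_j] := leP (a j 0) (b j 0); last first.
  rewrite [X in lebesgue X](_ : _ = set0) ?lebesgue0//.
    rewrite lee_fin mulr_ge0//.
      by apply: prodr_ge0 => k _; rewrite le_max lexx.
    by rewrite addr_ge0// ?divr_ge0 ?exprn_ge0// ?mulr_ge0// le_max lexx.
  apply/seteqP; split=> // y [x abx _]; have /andP[axj xbj] := abx j.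
  by have := le_trans axj xbj; rewrite leNgt ba_j.
pose m := (a j 0 + b j 0) / 2.
pose b1 : 'cV[R]_n := \col_k (if k == j then m else b k 0).
pose a2 : 'cV[R]_n := \col_k (if k == j then m else a k 0).
have half : [set (1%:M + c *: delta_mx i j) *m x | x in box a b] `<=`
    [set (1%:M + c *: delta_mx i j) *m x | x in box a b1] `|`
    [set (1%:M + c *: delta_mx i j) *m x | x in box a2 b].
  move=> _ [x abx <-]; have [xm|/ltW xm] := leP (x j 0) m; [left|right];
    exists x => // k; rewrite mxE; have /andP[ax xb] := abx k;
    case: eqP => [kj|_]; rewrite ?ax ?xb//= ?andbT.
  - by rewrite kj.
  - by rewrite kj.
apply: le_trans (lebesgue_le half) _; apply: le_trans (lebesgueU n_gt0 _ _) _.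
apply: le_trans (leeD (IHp _ _) (IHp _ _)) _.
have ji : j != i by rewrite eq_sym.
have lenE (a' b' : 'cV[R]_n) :
    (forall k, k != j -> a' k 0 = a k 0 /\ b' k 0 = b k 0) ->
    b' j 0 - a' j 0 = (b j 0 - a j 0) / 2 ->
    \prod_(k | k != i) len a' b' k *
      (len a' b' i + 2 * `|c| * len a' b' j / 2 ^+ p) =
    (\prod_(k | k != i) len a b k *
      (len a b i + 2 * `|c| * len a b j / 2 ^+ p.+1)) / 2.
  move=> ab' abj; rewrite (bigD1 j)//= [in RHS](bigD1 j)//=.
  rewrite (eq_bigr (len a b)); last first.
    by move=> k /andP[_ /ab'[ak bk]]; rewrite /len ak bk.
  have -> : len a' b' i = len a b i by rewrite /len; have [-> ->] := ab' _ neq_ij.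
  have -> : len a' b' j = len a b j / 2.
    by rewrite /len abj !max_r ?divr_ge0 ?subr_ge0.
  rewrite exprS; field.
  by rewrite expf_eq0/= (eqr_nat _ 2 0) andbF.
rewrite -EFinD lee_fin !lenE ?mxE ?eqxx//.
- by rewrite -splitr.
- by move=> k kj; rewrite mxE (negPf kj).
- by rewrite /m; field.
- by move=> k kj; rewrite mxE (negPf kj).
- by rewrite /m; field.
Qed.

(** Let the number of halvings tend to infinity. *)
Lemma scales_boxes_le_transvection (i j : 'I_n) (c : R) :
  i != j -> scales_boxes_le (1%:M + c *: delta_mx i j).
Proof.
move=> neq_ij a b; rewrite det_transvection// normr1 mul1r.
pose C := \prod_(k | k != i) len a b k * (2 * `|c| * len a b j).
have C0 : 0 <= C.
  rewrite mulr_ge0//; first by apply: prodr_ge0 => k _; rewrite le_max lexx.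
  by rewrite !mulr_ge0// le_max lexx.
apply/lee_addgt0Pr => e e0.
pose p := Num.bound (C / e).
have Cp : C / 2 ^+ p <= e.
  rewrite ler_pdivrMr ?exprn_gt0// mulrC -ler_pdivrMr//.
  apply/ltW/(lt_trans (archi_boundP _)); first by rewrite divr_ge0// ltW.
  by rewrite -natrX ltr_nat ltn_expl.
apply: le_trans (lebesgue_transvection_approx c p a b neq_ij) _.
rewrite -EFinD lee_fin mulrDr /box_volume [X in _ <= X + _](bigD1 i)//=.
by rewrite [X in X + _ <= _]mulrC lerD2l mulrA.
Qed.

Lemma lebesgue_image_le P X :
  (lebesgue [set P *m x | x in X] <= `|\det P|%:E * lebesgue X)%E.
Proof.
apply: lebesgue_image_le_of.
elim: {P} (elementary_productP P) => [d|i j c|P Q _ + _].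
- exact: scales_boxes_le_diag.
- exact: scales_boxes_le_transvection.
- exact: scales_boxes_leM.
Qed.

(** The converse inequality is the previous one for the inverse matrix. *)
Lemma lebesgue_image P X :
  lebesgue [set P *m x | x in X] = (`|\det P|%:E * lebesgue X)%E.
Proof.
have [P0|P0] := eqVneq (\det P) 0.
  apply/eqP; rewrite P0 normr0 mul0e eq_le lebesgue_ge0 andbT.
  by apply: le_trans (lebesgue_image_le P X) _; rewrite P0 normr0 mul0e.
apply/eqP; rewrite eq_le lebesgue_image_le/=.
have Pu : P \in unitmx by rewrite unitmxE unitfE.
rewrite -[X in (_ * lebesgue X)%E](_ : [set invmx P *m y |
    y in [set P *m x | x in X]] = X); last first.
  rewrite image_comp (_ : _ \o _ = id) ?image_id//.
  by apply/funext => x /=; rewrite mulKmx.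
apply: le_trans (lee_wpmul2l _ (lebesgue_image_le _ _)) _; first by rewrite lee_fin.
by rewrite det_inv muleA -EFinM -normrM mulfV// normr1 mul1e.
Qed.

End LinearImage.

Lemma mulmx_sum_col (R : comPzRingType) m n (X : 'M[R]_(m, n)) (x : 'cV[R]_n) :
  X *m x = \sum_i x i 0 *: col i X.
Proof.
apply/colP => k; rewrite summxE mxE; apply: eq_bigr => i _.
by rewrite !mxE mulrC.
Qed.

(** Each hyperplane is inside the range of a singular projector, and is thus
    null by [lebesgue_image]. *)
Lemma lebesgue_coord_hyperplanes (R : realType) n : (0 < n)%N ->
  lebesgue [set x : 'cV[R]_n | exists i, x i 0 = 0] = 0%E.
Proof.
move=> n_gt0; apply/eqP; rewrite eq_le lebesgue_ge0 andbT.
pose H k := [set x : 'cV[R]_n | exists2 i : 'I_n, i = k :> nat & x i 0 = 0].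
have H0 k : lebesgue (H k) = 0%E.
  apply/eqP; rewrite eq_le lebesgue_ge0 andbT.
  have [lt_kn|le_nk] := ltnP k n; last first.
    rewrite (_ : H k = set0) ?lebesgue0//; apply/seteqP; split=> // x [i ik _].
    by have := ltn_ord i; rewrite ik ltnNge le_nk.
  pose i := Ordinal lt_kn; pose P : 'M[R]_n := diag_mx (\row_j (j != i)%:R).
  have P0 : \det P = 0 by rewrite det_diag (bigD1 i)//= mxE eqxx mul0r.
  apply: (@le_trans _ _ (lebesgue [set P *m x | x in setT])); last first.
    by rewrite lebesgue_image// P0 normr0 mul0e.
  apply: lebesgue_le => x [j jk xj]; exists x => //.
  apply/colP => l; rewrite mul_diag_mx !mxE.
  have [->|_] := eqVneq l i; last by rewrite mul1r.
  by rewrite mul0r -xj; congr (x _ 0); apply: val_inj.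
apply: (@le_trans _ _ (lebesgue (\bigcup_k H k))).
  by apply: lebesgue_le => x [i xi]; exists (i : nat) => //; exists i.
by apply: le_trans (lebesgue_bigcup _) _; rewrite eseries0.
Qed.

(** * Ellipsoids, pseudoinverses and factorizations *)

Section UnitBall.
Context (R : realType) (n : nat).
Hypothesis n_gt0 : (0 < n)%N.

Let ball1 := [set x : 'cV[R]_n | sqnorm x <= 1].

Lemma lebesgue_ball_fin_num : lebesgue ball1 \is a fin_num.
Proof.
rewrite ge0_fin_numE ?lebesgue_ge0//.
have sub : ball1 `<=` box (const_mx (-1)) (const_mx 1).
  move=> x; rewrite /ball1 /= /sqnorm => x1 i; rewrite !mxE -ler_norml.
  rewrite -(@expr_le1 _ 2)// real_normK ?num_real//.
  apply: le_trans x1; rewrite (bigD1 i)//= lerDl sumr_ge0// => j _.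
  exact: sqr_ge0.
apply: le_lt_trans (lebesgue_le sub) _.
by apply: le_lt_trans (lebesgue_box_le n_gt0 _ _) _; rewrite ltry.
Qed.

(** The ball contains the cube with sides [-1/n, 1/n]: there the squared norm
    is at most n * (1/n)^2 <= 1. *)
Lemma lebesgue_ball_gt0 : (0 < lebesgue ball1)%E.
Proof.
pose c : 'cV[R]_n := const_mx n%:R^-1.
have n0 : 0 < n%:R^-1 :> R by rewrite invr_gt0 ltr0n.
apply: (@lt_le_trans _ _ (lebesgue (box (- c) c))).
  rewrite lebesgue_box// lte_fin prodr_gt0// => i _.
  by rewrite !mxE lt_max; apply/orP; right; lra.
apply: lebesgue_le => x xc; rewrite /ball1 /= /sqnorm.
apply: (@le_trans _ _ (\sum_(i < n) n%:R^-1)); last first.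
  by rewrite sumr_const card_ord -[_ *+ n]mulr_natr mulVf// pnatr_eq0 -lt0n.
apply: ler_sum => i _; have := xc i; rewrite !mxE -ler_norml => xi.
rewrite -real_normK ?num_real// expr2.
apply: (@le_trans _ _ (n%:R^-1 * 1)); last by rewrite mulr1.
apply: ler_pM => //; apply: le_trans xi _.
by rewrite invf_le1 ?ltr0n// ler1n.
Qed.

Lemma volume_ellipsoid (P : 'M[R]_n) :
  volume [set P *m x | x in [set x | sqnorm x <= 1]] = `|\det P|%:E.
Proof.
rewrite /volume lebesgue_image// -muleA -[X in (_ * (X * _))%E]fineK; last first.
  exact: lebesgue_ball_fin_num.
rewrite -EFinM mulfV ?mulr1 ?mule1// lt0r_neq0// fine_gt0// lebesgue_ball_gt0/=.
by rewrite ltey_eq lebesgue_ball_fin_num.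
Qed.

End UnitBall.

Section LeastSquares.
Context (R : realType).

Lemma sqnormE n (v : 'cV[R]_n) : sqnorm v = (v^T *m v) 0 0.
Proof. by rewrite mxE; apply: eq_bigr => i _; rewrite mxE expr2. Qed.

Lemma sqnorm_ge0 n (v : 'cV[R]_n) : 0 <= sqnorm v.
Proof. by apply: sumr_ge0 => i _; exact: sqr_ge0. Qed.

Lemma sqnorm_eq0 n (v : 'cV[R]_n) : sqnorm v = 0 -> v = 0.
Proof.
move=> /eqP; rewrite psumr_eq0 => [/allP v0|i _]; last exact: sqr_ge0.
apply/colP => i; rewrite mxE; apply/eqP; rewrite -sqrf_eq0.
by apply: v0; rewrite mem_index_enum.
Qed.

Lemma sqnorm_orthogonalD n (u v : 'cV[R]_n) :
  u^T *m v = 0 -> sqnorm (u + v) = sqnorm u + sqnorm v.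
Proof.
move=> uv; have vu : v^T *m u = 0.
  by rewrite -[LHS]trmxK trmx_mul trmxK uv trmx0.
by rewrite !sqnormE [(u + v)^T]raddfD /= mulmxDl !mulmxDr uv vu addr0 add0r mxE.
Qed.

Lemma gram_unit m n (L : 'M[R]_(m, n)) :
  (forall v : 'cV[R]_n, L *m v = 0 -> v = 0) -> L^T *m L \in unitmx.
Proof.
move=> Linj; rewrite -unitmx_tr -row_free_unit; apply/row_freeP.
suff: kermx (L^T *m L)^T == 0.
  by rewrite kermx_eq0 => /row_freeP.
apply/eqP/row_matrixP => i; rewrite row0; apply: trmx_inj; rewrite trmx0.
apply/Linj/sqnorm_eq0; set v := (row _ _)^T.
have : row i (kermx (L^T *m L)^T) *m (L^T *m L)^T = 0.
  by rewrite -row_mul mulmx_ker row0.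
move=> /(congr1 trmx); rewrite trmx_mul trmxK -/v trmx0 => LLv.
by rewrite sqnormE trmx_mul -mulmxA [L^T *m _]mulmxA LLv mulmx0 mxE.
Qed.

(** For a full-rank factorization L K, the pseudoinverse is the product of the
    right inverse of K and the left inverse of L given by the Gram matrices. *)
Lemma moore_penrose_factor m r n (L : 'M[R]_(m, r)) (K : 'M[R]_(r, n)) :
  L^T *m L \in unitmx -> K *m K^T \in unitmx ->
  moore_penrose (L *m K)
    (K^T *m invmx (K *m K^T) *m invmx (L^T *m L) *m L^T).
Proof.
move=> Lu Ku; set P := (X in moore_penrose _ X).
have MP : L *m K *m P = L *m invmx (L^T *m L) *m L^T.
  by rewrite /P -!mulmxA (mulmxA K K^T) mulKVmx.
have PM : P *m (L *m K) = K^T *m invmx (K *m K^T) *m K.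
  by rewrite /P -!mulmxA (mulmxA L^T L) mulKmx.
have symV k (G : 'M[R]_k) : G^T = G -> (invmx G)^T = invmx G.
  by move=> GE; rewrite trmx_inv GE.
split.
- by rewrite MP -!mulmxA (mulmxA L^T L) mulKmx.
- by rewrite PM /P -!mulmxA (mulmxA K K^T) mulKVmx.
- by rewrite MP !trmx_mul trmxK symV ?mulmxA// trmx_mul trmxK.
- by rewrite PM !trmx_mul trmxK symV ?mulmxA// trmx_mul trmxK.
Qed.

Lemma moore_penrose_exists m n (M : 'M[R]_(m, n)) : exists P, moore_penrose M P.
Proof.
rewrite -(mulmx_base M); eexists; apply: moore_penrose_factor.
  apply: gram_unit => v Lv; have /row_fullP[L' L'L] := col_base_full M.
  by rewrite -[v]mul1mx -L'L -mulmxA Lv mulmx0.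
rewrite -[X in X *m _]trmxK; apply: gram_unit => v Kv.
have /row_freeP[K' KK'] := row_base_free M.
by rewrite -[v]mul1mx -trmx1 -KK' trmx_mul -mulmxA Kv mulmx0.
Qed.

Lemma mpinvP m n (M : 'M[R]_(m, n)) : moore_penrose M (mpinv M).
Proof. by have [P] := moore_penrose_exists M; exact: xgetI. Qed.

(** Q = M M^+ is the orthogonal projector on the range of M, so c - Q c is
    orthogonal to every Q c + M y, and Pythagoras applies. *)
Lemma sqnorm_least_squares m n (M : 'M[R]_(m, n))
    (c : 'cV[R]_m) (y : 'cV[R]_n) :
  sqnorm (c - M *m mpinv M *m c) <= sqnorm (c + M *m y).
Proof.
have [QM + Qs _] := mpinvP M.
have : M *m mpinv M *m (M *m mpinv M) = M *m mpinv M.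
  by rewrite mulmxA QM.
move: (M *m mpinv M) QM Qs => Q QM Qs QQ _.
have -> : c + M *m y = (c - Q *m c) + (Q *m c + M *m y) by rewrite addrA subrK.
rewrite [leRHS]sqnorm_orthogonalD ?lerDl ?sqnorm_ge0//.
rewrite [(c - _)^T]raddfB /= trmx_mul Qs mulmxBl !mulmxDr -!mulmxA.
by rewrite (mulmxA Q Q) QQ (mulmxA Q M) QM subrr.
Qed.

(** Induction on the size: positivity on the first basis vector gives the
    corner a > 0, and positivity on the vectors (- b v / a, v) is positivity of
    the Schur complement S = D - b^T b / a. *)
Lemma cholesky n (Q : 'M[R]_n) : Q^T = Q ->
  (forall v : 'cV[R]_n, v != 0 -> 0 < (v^T *m Q *m v) 0 0) ->
  exists P : 'M[R]_n, P^T *m P = Q.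
Proof.
elim: n Q => [|n IHn] Q Qs Qpos; first by exists 0; apply/matrixP => -[].
move: Q Qs Qpos; rewrite -[n.+1]/(1 + n)%N => Q.
rewrite -[Q]submxK; set a := ulsubmx Q; set b := ursubmx Q; set c := dlsubmx Q.
set D := drsubmx Q; rewrite tr_block_mx => /eq_block_mx[_ _ bc Ds] Qpos.
have a_gt0 : 0 < a 0 0.
  have := Qpos (col_mx 1%:M 0); rewrite tr_col_mx mul_row_block mul_row_col.
  rewrite !trmx1 !mul1mx trmx0 !mul0mx !mulmx0 !addr0 mulmx1; apply.
  by rewrite col_mx_eq0 oner_eq0.
pose S := D - (a 0 0)^-1 *: (b^T *m b).
have Ss : S^T = S.
  by rewrite [S^T]raddfB [X in _ - X]linearZ /= trmx_mul trmxK Ds.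
have [v v0|P PS] := IHn S Ss.
  pose u : 'cV[R]_1 := - (a 0 0)^-1 *: (b *m v).
  have au : a *m u + b *m v = 0.
    by rewrite [a]mx11_scalar mul_scalar_mx scalerA mulrN mulfV ?gt_eqF//
      scaleN1r addNr.
  have := Qpos (col_mx u v); rewrite -mulmxA mul_block_col au tr_col_mx.
  rewrite mul_row_col.
  rewrite mulmx0 add0r -bc -scalemxAr scaleNr addrC (mulmxA b^T) scalemxAl.
  rewrite -mulmxBl -/S mulmxA.
  apply; by rewrite col_mx_eq0 negb_and v0 orbT.
pose s := Num.sqrt (a 0 0).
have ss : s * s = a 0 0 by rewrite -expr2 sqr_sqrtr// ltW.
have s0 : s != 0 by rewrite sqrtr_eq0 -ltNge.
exists (block_mx s%:M (s^-1 *: b) 0 P).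
rewrite tr_block_mx trmx0 tr_scalar_mx mulmx_block !mul0mx !mulmx0 !addr0 PS.
rewrite -scalar_mxM ss -mx11_scalar [(s^-1 *: b)^T]linearZ /= bc.
rewrite mul_scalar_mx mul_mx_scalar.
rewrite !scalerA mulfV// !scale1r -scalemxAl -scalemxAr scalerA -invfM ss.
by rewrite /S bc addrC subrK.
Qed.
End LeastSquares.

(** * The minimal control energy *)

Section System.
Context (R : realType) (Nx Nu T : nat).
Variables (A : 'M[R]_Nx) (B : 'M[R]_(Nx, Nu)).
Variables (Zu : 'I_T -> {set 'I_Nu * 'I_Nx}) (Zx : 'I_T -> {set 'I_Nx * 'I_Nx}).
Variables (r : 'I_Nx -> nat) (omega : 'I_Nx -> 'cV[R]_(\sum_(s < T) Nu)).
Variable V : forall i : 'I_Nx, 'M[R]_(\sum_(s < T) Nu, r i).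
Hypothesis general_solution :
  forall (i : 'I_Nx) (Phi : 'cV[R]_(\sum_(s < T) Nu)),
    S_col A B Zu Zx i *m Phi + C_col Nu A Zx i = 0 <->
    exists lambda : 'cV[R]_(r i), Phi = omega i + V i *m lambda.

Let M : 'M[R]_(\sum_(s < T) Nu, \sum_(i < Nx) r i) := \mxrow_(i < Nx) V i.
Let N : 'M[R]_(\sum_(s < T) Nu, Nx) := \matrix_(l, i) omega i l 0.
Let W := - (M *m mpinv M *m N) + N.

Lemma cost_sqnorm (phi : 'I_T -> 'M[R]_(Nu, Nx)) (x0 : 'cV[R]_Nx) :
  cost phi x0 = sqnorm (\mxcol_(s < T) phi s *m x0).
Proof.
rewrite /cost -mul_mxrow_mxcol -tr_mxcol sqnormE trmx_mul.
by rewrite !mulmxA.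
Qed.

Lemma feasible_mulmx (phi : 'I_T -> 'M[R]_(Nu, Nx))
    (lambda : forall i, 'cV[R]_(r i)) (x0 : 'cV[R]_Nx) :
  (forall i, stack phi i = omega i + V i *m lambda i) ->
  \mxcol_(s < T) phi s *m x0 =
  N *m x0 + M *m \mxcol_(i < Nx) (x0 i 0 *: lambda i).
Proof.
move=> phiE; rewrite mul_mxrow_mxcol !mulmx_sum_col -big_split/=.
apply: eq_bigr => i _; rewrite col_mxcol -/(stack phi i) phiE.
rewrite scalerDr scalemxAr.
by congr (_ *: _ + _); apply/colP => l; rewrite !mxE.
Qed.

Lemma feasibleP (phi : 'I_T -> 'M[R]_(Nu, Nx)) : constraints A B Zu Zx phi ->
  exists lambda : forall i, 'cV[R]_(r i),
    forall i, stack phi i = omega i + V i *m lambda i.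
Proof.
move=> /constraintsE cphi; have ex i := (general_solution i _).1 (cphi i).
by exists (fun i => projT1 (cid (ex i))) => i; case: cid.
Qed.

Lemma feasible_of (lambda : forall i, 'cV[R]_(r i)) :
  exists2 phi : 'I_T -> 'M[R]_(Nu, Nx), constraints A B Zu Zx phi &
    forall i, stack phi i = omega i + V i *m lambda i.
Proof.
pose Phi : 'M[R]_(\sum_(s < T) Nu, Nx) :=
  \matrix_(l, i) (omega i + V i *m lambda i) l 0.
pose phi (s : 'I_T) : 'M[R]_(Nu, Nx) := submxcol Phi s.
have phiE i : stack phi i = omega i + V i *m lambda i.
  rewrite /stack -col_mxcol submxcolK; apply/colP => l.
  by rewrite [LHS]mxE [LHS]mxE.
exists phi => //; apply/constraintsE => i; apply/general_solution.
by exists (lambda i).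
Qed.

(** The default value in the definition of h_c is never taken.  The controls
    applied from x0 form the affine space N x0 + range K, where
    K = [x0_1 V_1, ..., x0_n V_n] may have smaller range than M; its shortest
    vector is given by the pseudoinverse of K. *)
Lemma h_cP (x0 : 'cV[R]_Nx) :
  (exists2 phi, constraints A B Zu Zx phi & cost phi x0 = h_c A B Zu Zx x0) /\
  (forall phi, constraints A B Zu Zx phi -> h_c A B Zu Zx x0 <= cost phi x0).
Proof.
pose E := [set cost phi x0 | phi in [set phi | constraints A B Zu Zx phi]].
suff : [set m | E m /\ lbound E m] (h_c A B Zu Zx x0).
  move=> [[phi cphi phiE] hE]; split; first by exists phi.
  by move=> psi cpsi; apply: hE; exists psi.
pose K := \mxrow_(i < Nx) (x0 i 0 *: V i).
have KE (lambda : forall i, 'cV[R]_(r i)) :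
    M *m \mxcol_(i < Nx) (x0 i 0 *: lambda i) = K *m \mxcol_(i < Nx) lambda i.
  rewrite !mul_mxrow_mxcol; apply: eq_bigr => i _.
  by rewrite -scalemxAr -scalemxAl.
pose y := - (mpinv K *m (N *m x0)).
have [phi cphi phiE] := feasible_of (fun i => submxcol y i).
apply: (@xgetI _ _ _ (cost phi x0)); split; first by exists phi.
move=> _ [psi /feasibleP[lambda psiE] <-].
rewrite !cost_sqnorm (feasible_mulmx _ phiE) (feasible_mulmx _ psiE) !KE.
by rewrite submxcolK mulmxN (mulmxA K); exact: sqnorm_least_squares.
Qed.

Let mulW (x0 : 'cV[R]_Nx) : W *m x0 = N *m x0 - M *m mpinv M *m (N *m x0).
Proof. by rewrite mulmxDl mulNmx addrC (mulmxA _ N). Qed.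

(** The controls applied from x0 all lie in N x0 + range M. *)
Lemma h_c_ge (x0 : 'cV[R]_Nx) : sqnorm (W *m x0) <= h_c A B Zu Zx x0.
Proof.
have [[phi /feasibleP[lambda phiE] <-] _] := h_cP x0.
rewrite cost_sqnorm (feasible_mulmx _ phiE) mulW.
exact: sqnorm_least_squares.
Qed.

(** The coefficients y of the projection on range M are reached by the choice
    lambda_i = y_i / x0_i. *)
Lemma h_c_generic (x0 : 'cV[R]_Nx) : (forall i, x0 i 0 != 0) ->
  h_c A B Zu Zx x0 = sqnorm (W *m x0).
Proof.
move=> x0_neq0; apply/eqP; rewrite eq_le h_c_ge andbT.
pose y := - (mpinv M *m (N *m x0)).
have [phi cphi phiE] := feasible_of (fun i => (x0 i 0)^-1 *: submxcol y i).
apply: le_trans ((h_cP x0).2 _ cphi) _.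
rewrite cost_sqnorm (feasible_mulmx _ phiE) mulW.
under eq_mxcol do rewrite scalerA mulfV// scale1r.
by rewrite submxcolK mulmxN (mulmxA M).
Qed.

(** With G the matrix from inputs to the final state, the terminal constraint
    holds for all values of the lambda_i, so its constant part gives
    G N = - A^T and its linear part gives G M = 0.  As W x0 = 0 puts N x0 in
    the range of M, A^T x0 = - G N x0 = 0. *)
Lemma ker_W (x0 : 'cV[R]_Nx) : W *m x0 = 0 -> A ^+ T *m x0 = 0.
Proof.
move=> Wx0; pose G : 'M[R]_(Nx, \sum_(s < T) Nu) := input_to_state T A B T.
have term (lambda : forall i, 'cV[R]_(r i)) i :
    col i (A ^+ T) + G *m (omega i + V i *m lambda i) = 0.
  have [phi [_ _ phiT] phiE] := feasible_of lambda.
  by rewrite -phiE -phi_xE// phiT col0.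
have GN : G *m N = - A ^+ T.
  apply/eqP; rewrite -addr_eq0; apply/eqP/matrixP => k i.
  have /colP/(_ k) := term (fun=> 0) i; rewrite mulmx0 addr0 => term_k.
  transitivity ((0 : 'cV[R]_Nx) k 0); last by rewrite !mxE.
  rewrite -term_k.
  rewrite [LHS]mxE [RHS]mxE addrC; congr (_ + _); first by rewrite mxE.
  by rewrite [LHS]mxE [RHS]mxE; apply: eq_bigr => l _; rewrite [N l i]mxE.
have GM : G *m M = 0.
  rewrite mul_mxrow -mxrow0; apply/eq_mxrowP => i.
  apply/matrixP => k l.
  (* A basis vector for block i, with a meaning in every block. *)
  pose lambda j : 'cV[R]_(r j) := \col_m (m == l :> nat)%:R.
  have := term lambda i; rewrite mulmxDr addrA.
  have := term (fun=> 0) i; rewrite mulmx0 addr0 => ->; rewrite add0r mulmxA.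
  move=> /colP/(_ k); rewrite [RHS]mxE => GVk; rewrite [RHS]mxE -GVk.
  rewrite [RHS]mxE (bigD1 l)//= [lambda i l 0]mxE eqxx mulr1.
  rewrite [X in _ + X]big1 => [|m ml]; first by rewrite addr0.
  by rewrite [lambda i m 0]mxE (inj_eq val_inj) (negPf ml) mulr0.
have : N *m x0 = M *m (mpinv M *m (N *m x0)).
  by apply/eqP; rewrite -subr_eq0 (mulmxA M) -mulW Wx0 eqxx.
move=> /(congr1 (mulmx G)); rewrite !mulmxA GM !mul0mx GN mulNmx.
by move=> /eqP; rewrite oppr_eq0 => /eqP.
Qed.
End System.

(** * The volume formula *)

Theorem proposition6 (R : realType) (Nx Nu T : nat)
    (Nx_gt0 : (0 < Nx)%N) (Nu_gt0 : (0 < Nu)%N) (T_gt0 : (0 < T)%N)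
    (A : 'M[R]_Nx) (B : 'M[R]_(Nx, Nu))
    (Zu : 'I_T -> {set 'I_Nu * 'I_Nx}) (Zx : 'I_T -> {set 'I_Nx * 'I_Nx})
    (solvable_c : exists phi : 'I_T -> 'M[R]_(Nu, Nx), constraints A B Zu Zx phi)
    (r : 'I_Nx -> nat)
    (omega : 'I_Nx -> 'cV[R]_(\sum_(s < T) Nu))
    (V : forall i : 'I_Nx, 'M[R]_(\sum_(s < T) Nu, r i))
    (general_solution : forall (i : 'I_Nx) (Phi : 'cV[R]_(\sum_(s < T) Nu)),
       S_col A B Zu Zx i *m Phi + C_col Nu A Zx i = 0 <->
       exists lambda : 'cV[R]_(r i), Phi = omega i + V i *m lambda)
    (full_column_rank : forall i : 'I_Nx, \rank (V i) = r i) :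
  let M : 'M[R]_(\sum_(s < T) Nu, \sum_(i < Nx) r i) := \mxrow_(i < Nx) V i in
  let N : 'M[R]_(\sum_(s < T) Nu, Nx) := \matrix_(l, i) omega i l 0 in
  let W := - (M *m mpinv M *m N) + N in
  let E := [set A ^+ T *m x0 | x0 in [set x0 : 'cV[R]_Nx | sqnorm (W *m x0) <= 1]] in
  Y_c A B Zu Zx = volume E /\
  volume E = (`|\det (A ^+ T)| / Num.sqrt (\det (W^T *m W)))%:E.
Proof.
move=> M N W E; set G := A ^+ T.
have [G0|G0] := eqVneq (\det G) 0.
  rewrite /Y_c /E /volume !lebesgue_image// G0 normr0 !mul0e.
  by rewrite mul0r.
have Wge := h_c_ge general_solution : forall x0, sqnorm (W *m x0) <= _.
have Wgen := h_c_generic general_solution :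
  forall x0, _ -> _ = sqnorm (W *m x0).
split.
  (* Only the coordinate hyperplanes separate the two sublevel sets. *)
  congr (_ * _)%E; apply/eqP; rewrite eq_le; apply/andP; split.
    apply: lebesgue_le => _ [x0 hx0 <-]; exists x0 => //.
    exact: le_trans (Wge x0) hx0.
  pose H := [set x : 'cV[R]_Nx | exists i, x i 0 = 0].
  have EYH : E `<=` [set G *m x0 | x0 in [set x0 | h_c A B Zu Zx x0 <= 1]] `|`
                    [set G *m x0 | x0 in H].
    move=> _ [x0 Wx0 <-]; have [Hx0|Hx0] := pselect (H x0); [right|left];
      exists x0 => //.
    rewrite /= Wgen// => i; apply/eqP => x0i; apply: Hx0.
    by exists i.
  apply: le_trans (lebesgue_le EYH) _; apply: le_trans (lebesgueU Nx_gt0 _ _) _.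
  rewrite (lebesgue_image Nx_gt0 G H).
  by rewrite [lebesgue H]lebesgue_coord_hyperplanes// mule0 adde0.
(* W is injective because its kernel is inside that of the invertible G. *)
have Wuni : W^T *m W \in unitmx.
  apply: gram_unit => v /(ker_W general_solution) Gv0.
  have Gu : G \in unitmx by rewrite unitmxE unitfE.
  by rewrite -[v](mulKmx Gu) Gv0 mulmx0.
(* |W x| = |P x|, so that E is the image of the unit ball under G P^-1. *)
have [|v v0|P PE] := @cholesky _ _ (W^T *m W).
- by rewrite trmx_mul trmxK.
- rewrite mulmxA -trmx_mul -mulmxA -sqnormE lt_def sqnorm_ge0 andbT.
  apply: contraNneq v0 => /sqnorm_eq0 Wv; apply/eqP.
  by rewrite -[v](mulKmx Wuni) -mulmxA Wv !mulmx0.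
have detP : \det (W^T *m W) = \det P ^+ 2 by rewrite -PE det_mulmx det_tr expr2.
have Pu : P \in unitmx.
  rewrite unitmxE unitfE; move: Wuni; rewrite unitmxE unitfE detP.
  by rewrite expf_eq0.
have EE : E = [set (G *m invmx P) *m y | y in [set y | sqnorm y <= 1]].
  have WP x0 : sqnorm (W *m x0) = sqnorm (P *m x0).
    by rewrite !sqnormE !trmx_mul -!mulmxA (mulmxA W^T) -PE -mulmxA.
  apply/seteqP; split=> _ [x x1 <-].
    by exists (P *m x); rewrite /= -?WP// -mulmxA mulKmx.
  by exists (invmx P *m x); rewrite /= ?WP ?mulKVmx// mulmxA.
rewrite EE volume_ellipsoid// det_mulmx det_inv detP sqrtr_sqr normrM.
by rewrite normfV.
Qed.
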